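(* Let $G$ be a graph with at least one edge, degree sequence $d_1\leq\cdots\leq d_n$, maximum degree $\Delta$, annihilation number $a=a(G)$, and $S_H(G)=\sum_{i=1}^{a}d_i$. Then $$a(G)=\frac{\Delta(G)+1}{2}\,W(G)$$ if and only if all three of the following conditions hold: (i) $S_H(G)=\Delta(n-a)$; (ii) $d_i\in\{\Delta-1,\Delta\}$ for $1\leq i\leq a$; (iii) $d_i=\Delta$ for $a+1\leq i\leq n$. Equivalently, the equality holds if and only if $\sigma_\Delta(G)=0$.
   Context: All graphs are finite, simple and undirected. For a graph $G$ with $m(G)$ edges and degree sequence $d_1\leq\cdots\leq d_n$, the annihilation number is $a=a(G)=\max\{k : \sum_{i=1}^k d_i\leq m(G)\}$, and the Caro–Wei sum is $W(G)=\sum_{i=1}^n\frac{1}{d_i+1}$. With $\Delta=\Delta(G)\geq 1$ the maximum degree and $S_H(G)=\sum_{i=1}^{a}d_i$, define $$\sigma_\Delta(G)=\frac{\Delta(n-a)-S_H(G)}{2\Delta}+\sum_{i=1}^{a}\frac{(\Delta-d_i)(\Delta-d_i-1)}{2\Delta(d_i+1)}+\sum_{i=a+1}^{n}\frac{\Delta-d_i}{2(d_i+1)} .$$ *)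

(* Defs.v *)
From mathcomp Require Import all_boot all_order all_algebra.

Set Implicit Arguments.
Unset Strict Implicit.
Unset Printing Implicit Defensive.

Import GRing.Theory Num.Theory.

Record sgraph := SGraph {
  vertex :> finType;
  adj : rel vertex;
  adj_sym : symmetric adj;
  adj_irrefl : irreflexive adj
}.

Definition nb_vertices (G : sgraph) : nat := #|G|.

Definition edges (G : sgraph) : {set {set G}} :=
  [set E : {set G} | [exists x, exists y, adj x y && (E == [set x; y])]].

Definition nb_edges (G : sgraph) : nat := #|edges G|.

Definition degree (G : sgraph) (v : G) : nat := #|[set w | adj v w]|.

Definition max_degree (G : sgraph) : nat := \max_(v : G) degree v.

Definition degree_seq (G : sgraph) : seq nat :=
  sort leq [seq degree v | v <- enum G].

(* Indices start at 0: [dseq G i] is the (i+1)-st smallest degree, so the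
   range 1 <= i <= a of the mathematics is [i < a] here. *)
Definition dseq (G : sgraph) (i : nat) : nat := nth 0 (degree_seq G) i.

Definition annihilation_number (G : sgraph) : nat :=
  \max_(k < (nb_vertices G).+1 | \sum_(i < k) dseq G i <= nb_edges G) k.

Definition SH (G : sgraph) : nat :=
  \sum_(i < annihilation_number G) dseq G i.

Local Open Scope ring_scope.

Definition caro_wei (G : sgraph) : rat :=
  \sum_(i < nb_vertices G) 1 / ((dseq G i)%:R + 1).

Definition sigma (G : sgraph) : rat :=
  let n := nb_vertices G in
  let a := annihilation_number G in
  let Delta : rat := (max_degree G)%:R in
  let d (i : nat) : rat := (dseq G i)%:R in
  (Delta * (n%:R - a%:R) - (SH G)%:R) / (2 * Delta)
  + \sum_(0 <= i < a)
      ((Delta - d i) * (Delta - d i - 1)) / (2 * Delta * (d i + 1))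
  + \sum_(a <= i < n) (Delta - d i) / (2 * (d i + 1)).

(* Main.v *)
(** The rational function [sigma] is [(Delta + 1) / 2 * W - a], by expanding each
    summand in partial fractions with respect to [d_i + 1]. Its three parts are
    nonnegative: the two sums because the degrees are integers at most [Delta],
    and the first part because [2 * S_H <= 2 * m <= \sum_i d_i], so that
    [S_H <= \sum_(i > a) d_i <= Delta * (n - a)]. Hence [sigma] vanishes exactly
    when all its summands do. *)
Require Import Defs.
From mathcomp Require Import all_boot all_order all_algebra.
From mathcomp Require Import ring lra zify.
Import Order.TTheory GRing.Theory Num.Theory.
Local Open Scope ring_scope.

Section Degrees.
Local Open Scope nat_scope.
Variable G : sgraph.

(** The degree sum counts the ordered adjacent pairs. Sending [(x, y)] to [[set x; y]] maps these to
    edges, and each fibre contains the two distinct pairs [(x, y)] and [(y, x)]. *)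
Lemma double_nb_edges_le : 2 * nb_edges G <= \sum_(v : G) degree v.
Proof.
pose P := [set p : G * G | adj p.1 p.2].
have -> : \sum_(v : G) degree v = #|P|.
  rewrite -sum1_card (eq_bigr (fun v : G => \sum_(w : G | adj v w) 1)); last first.
    by move=> v _; rewrite sum1_card /degree cardsE.
  by rewrite pair_big_dep /=; apply: eq_bigl => p; rewrite inE.
rewrite -sum1_card (partition_big (fun p : G * G => [set p.1; p.2])
  (mem (edges G))) /=; last first.
  move=> [x y]; rewrite !inE /= => xy.
  by apply/existsP; exists x; apply/existsP; exists y; rewrite xy eqxx.
rewrite mulnC /nb_edges -sum_nat_const; apply: leq_sum => E.
rewrite inE => /existsP[x /existsP[y /andP[xy /eqP ->]]].
have xNy : x != y by apply: contraTneq xy => ->; rewrite adj_irrefl.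
rewrite sum1_card.
have -> : 2 = #|[set (x, y); (y, x)]|.
  by rewrite cards2 xpair_eqE (negPf xNy).
apply: subset_leq_card; apply/subsetP => p; rewrite !inE.
by case/orP => /eqP -> /=; rewrite unfold_in /= inE /= ?xy ?(@adj_sym G y)
  ?xy ?eqxx // setUC eqxx.
Qed.

Lemma size_degree_seq : size (degree_seq G) = nb_vertices G.
Proof. by rewrite size_sort size_map -cardE. Qed.

Lemma sum_dseq : \sum_(0 <= i < nb_vertices G) dseq G i = \sum_(v : G) degree v.
Proof.
rewrite -size_degree_seq -(big_nth 0 predT id) /degree_seq.
by rewrite (perm_big _ (permEl (perm_sort _ _))) big_map big_enum.
Qed.

Lemma dseq_le_max_degree i : dseq G i <= max_degree G.
Proof.
(* Past the end of the sequence [dseq] takes the default value 0, so the bound holds at every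
   index. *)
have [ilt|ige] := ltnP i (size (degree_seq G)); last by rewrite /dseq nth_default.
rewrite /dseq; have := mem_nth 0 ilt; rewrite mem_sort => /mapP[v _ ->].
exact: leq_bigmax.
Qed.

(** An endpoint of an edge has a neighbour. This makes the divisions by [2 * Delta] in [sigma]
    genuine. *)
Lemma max_degree_gt0 : 0 < nb_edges G -> 0 < max_degree G.
Proof.
case/card_gt0P => E; rewrite inE => /existsP[x /existsP[y /andP[xy _]]].
apply: leq_trans (leq_bigmax x).
by apply/card_gt0P; exists y; rewrite inE.
Qed.

Lemma annihilation_number_le : annihilation_number G <= nb_vertices G.
Proof. by apply/bigmax_leqP => k _; rewrite -ltnS. Qed.

Lemma SH_le_nb_edges : SH G <= nb_edges G.
Proof.
rewrite /SH /annihilation_number.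
(* The maximum is attained, since [k = 0] is admissible with an empty sum; the maximiser itself
   satisfies the constraint. *)
have [|k Hk ->] := @eq_bigmax_cond _
  [pred k : 'I_(nb_vertices G).+1 | \sum_(i < k) dseq G i <= nb_edges G] val.
  by apply/card_gt0P; exists ord0; rewrite inE /= big_ord0.
exact: Hk.
Qed.

Lemma SH_le : SH G <= max_degree G * (nb_vertices G - annihilation_number G).
Proof.
have := double_nb_edges_le; rewrite -sum_dseq.
rewrite (big_cat_nat (leq0n _) annihilation_number_le) /= big_mkord -/(SH G).
have : \sum_(annihilation_number G <= i < nb_vertices G) dseq G i
    <= max_degree G * (nb_vertices G - annihilation_number G).
  rewrite mulnC -sum_nat_const_nat; apply: leq_sum => i _.
  exact: dseq_le_max_degree.
have := SH_le_nb_edges; lia.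
Qed.

End Degrees.

Lemma sigmaE (G : sgraph) : (0 < max_degree G)%N ->
  sigma G = ((max_degree G)%:R + 1) / 2 * caro_wei G
            - (annihilation_number G)%:R.
Proof.
move=> D0; rewrite /sigma /caro_wei /SH.
have le_an := annihilation_number_le G.
move: (annihilation_number G) (nb_vertices G) le_an => a n le_an.
rewrite -(big_mkord predT (fun i => 1 / ((dseq G i)%:R + 1))).
rewrite (big_cat_nat (leq0n a) le_an) /= natr_sum.
rewrite -(big_mkord predT (fun i => (dseq G i)%:R)).
have {D0} : ((max_degree G)%:R : rat) != 0 by rewrite pnatr_eq0 -lt0n.
move: (max_degree G)%:R => D D0.
have d1 i : ((dseq G i)%:R + 1 : rat) != 0 by rewrite natr1 pnatr_eq0.
(* Summed over [i < a], the middle term cancels [S_H / (2 * D)] in the first part of [sigma], and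
   the constant gives [- a]. *)
rewrite [X in _ + X + _ = _](eq_bigr (fun i : nat =>
    (D + 1) / 2 * (1 / ((dseq G i)%:R + 1))
    + (dseq G i)%:R * (1 / (2 * D)) - 1)); last first.
  by move=> i _; field; rewrite D0 d1.
(* Here the constants add up to [- (n - a) / 2], cancelling the rest of the first part. *)
rewrite [X in _ + X = _](eq_bigr (fun i : nat =>
    (D + 1) / 2 * (1 / ((dseq G i)%:R + 1)) - 1 / 2)); last first.
  by move=> i _; field; rewrite d1.
rewrite !sumrB big_split /= -!mulr_sumr -mulr_suml !sumr_const_nat subn0.
rewrite -[1 / 2 *+ _]mulr_natr natrB //.
by field; rewrite D0.
Qed.

(** With [t = D - d] a natural number, [t * (t - 1)] is zero at [t = 0] and has two nonnegative
    factors from [t = 1] on; integrality excludes [0 < t < 1]. *)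
Lemma mul_pred_ge0 (d D : nat) : (d <= D)%N ->
  0 <= (D%:R - d%:R) * (D%:R - d%:R - 1) :> rat.
Proof.
rewrite leq_eqVlt => /predU1P[->|ltdD]; first by rewrite subrr mul0r.
have : d.+1%:R <= D%:R :> rat by rewrite ler_nat.
by rewrite -natr1 => le; apply: mulr_ge0; lra.
Qed.

Lemma sum_nat_eq0P (a b : nat) (F : nat -> rat) : (forall i, 0 <= F i) ->
  \sum_(a <= i < b) F i = 0 <-> (forall i, (a <= i < b)%N -> F i = 0).
Proof.
move=> F0; split => [/eqP|H]; last by rewrite big_nat big1.
rewrite psumr_eq0 // => /allP H i iab; apply/eqP.
by have := H i; rewrite mem_index_iota iab => /(_ isT).
Qed.

Lemma sigma_eq0P (G : sgraph) : (0 < max_degree G)%N ->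
  let n := nb_vertices G in
  let a := annihilation_number G in
  let Delta := max_degree G in
  sigma G = 0 <->
   [/\ (SH G = Delta * (n - a))%N,
       (forall i : nat, (i < a)%N ->
          dseq G i = (Delta - 1)%N \/ dseq G i = Delta)
     & (forall i : nat, (a <= i < n)%N -> dseq G i = Delta)].
Proof.
move=> Dgt0 n a D; rewrite /sigma -/n -/a -/D.
have D0 : 0 < D%:R :> rat by rewrite ltr0n.
have le_dD i : (dseq G i <= D)%N by exact: dseq_le_max_degree.
have d1 i : 0 < (dseq G i)%:R + 1 :> rat by rewrite natr1 ltr0n.
rewrite -natrB ?annihilation_number_le // -(natrM _ D (n - a)).
(* The vanishing of [A], [B] and [C] amounts to conditions (i), (ii) and (iii) respectively. *)
set A := _ / _; set B := \sum_(0 <= i < a) _; set C := \sum_(a <= i < n) _.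
have A0 : 0 <= A.
  by rewrite divr_ge0 ?mulr_ge0 ?ler0n // subr_ge0 ler_nat SH_le.
have FB i : 0 <= (D%:R - (dseq G i)%:R) * (D%:R - (dseq G i)%:R - 1)
    / (2 * D%:R * ((dseq G i)%:R + 1)) :> rat.
  by rewrite divr_ge0 ?mul_pred_ge0 ?mulr_ge0 // ltW.
have FC i : 0 <= (D%:R - (dseq G i)%:R) / (2 * ((dseq G i)%:R + 1)) :> rat.
  by rewrite divr_ge0 ?subr_ge0 ?ler_nat ?mulr_ge0 // ltW.
have B0 : 0 <= B by apply: sumr_ge0.
have C0 : 0 <= C by apply: sumr_ge0.
have AP : A = 0 <-> (SH G = D * (n - a))%N.
  rewrite /A; split=> [/eqP|->]; last by rewrite subrr mul0r.
  rewrite mulf_eq0 invr_eq0 mulf_eq0 (gt_eqF D0) orbF pnatr_eq0 orbF.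
  by rewrite subr_eq0 eqr_nat => /eqP.
have BP : B = 0 <-> (forall i : nat, (i < a)%N ->
    dseq G i = (D - 1)%N \/ dseq G i = D).
  rewrite /B sum_nat_eq0P //; split=> H i /H; last first.
    case=> ->; last by rewrite subrr !mul0r.
    (* The truncated [D - 1] casts to [D%:R - 1] because [D] is positive. *)
    by rewrite natrB // opprB addrCA subrr addr0 subrr mulr0 mul0r.
  move/eqP; rewrite mulf_eq0 invr_eq0 !mulf_eq0 (gt_eqF D0) (gt_eqF (d1 i)).
  rewrite pnatr_eq0 !orbF -addrA -opprD natr1 !subr_eq0 !eqr_nat.
  by case/orP=> /eqP ->; [right | left; rewrite subn1].
have CP : C = 0 <-> (forall i : nat, (a <= i < n)%N -> dseq G i = D).
  rewrite /C sum_nat_eq0P //; split=> H i /H; last by move->; rewrite subrr mul0r.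
  move/eqP; rewrite mulf_eq0 invr_eq0 mulf_eq0 (gt_eqF (d1 i)) pnatr_eq0 !orbF.
  by rewrite subr_eq0 eqr_nat => /eqP.
split=> [ABC0 | [/AP -> /BP -> /CP ->]]; last by rewrite !addr0.
by split; [apply/AP | apply/BP | apply/CP]; lra.
Qed.

Theorem corollary7p4 (G : sgraph) (hG : (0 < nb_edges G)%N) :
  let n := nb_vertices G in
  let a := annihilation_number G in
  let Delta := max_degree G in
  (a%:R = (Delta%:R + 1) / 2 * caro_wei G
   <->
   [/\ (SH G = Delta * (n - a))%N,
       (forall i : nat, (i < a)%N ->
          dseq G i = (Delta - 1)%N \/ dseq G i = Delta)
     & (forall i : nat, (a <= i < n)%N -> dseq G i = Delta)])
  /\
  (a%:R = (Delta%:R + 1) / 2 * caro_wei G <-> sigma G = 0).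
Proof.
move=> n a Delta.
have D0 := max_degree_gt0 G hG.
have eqP_sigma : a%:R = (Delta%:R + 1) / 2 * caro_wei G <-> sigma G = 0.
  (* [sigma G] is the right-hand side minus the left-hand side of the equality. *)
  rewrite sigmaE // -/a -/Delta.
  by split=> [->|/eqP]; [rewrite subrr | rewrite subr_eq0 => /eqP].
by split=> //; rewrite eqP_sigma; exact: sigma_eq0P.
Qed.
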